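(* The categories $\mathbf{ZLC}$ and $\mathbf{ZLBA}$ are dually equivalent.
   Context: $\mathbf{ZLC}$ is the category of zero-dimensional (having a base of clopen sets) locally compact Hausdorff spaces and continuous maps. A local Boolean algebra (LBA) is a pair $(A,I)$ where $A$ is a Boolean algebra ($0=1$ allowed) and $I$ is an ideal of $A$ (possibly $I=A$) which is dense in $A$, i.e. for every $a\in A\setminus\{0\}$ there is $b\in I\setminus\{0\}$ with $b\le a$. $\mathbf{LBA}$ is the category whose objects are all LBAs and whose morphisms $\varphi:(B,I)\to(B_1,I_1)$ are all Boolean homomorphisms $\varphi:B\to B_1$ such that for every $b\in I_1$ there exists $a\in I$ with $b\le\varphi(a)$; composition and identities are the usual ones of functions. For an LBA $(B,I)$, regard $I$ as a distributive pseudolattice with bottom. An ideal $J$ of $I$ is a (nonempty) lower subset of $I$ closed under finite joins. Put $\neg J=\{a\in I\mid a\wedge b=0\text{ for all }b\in J\}$. The ideal $J$ is simple if $J\vee\neg J=I$ in the lattice of ideals of $I$, i.e. every element of $I$ is the join of an element of $J$ and an element of $\neg J$. $Si(I)$ denotes the set of simple ideals of $I$. An LBA $(B,I)$ is a ZLB-algebra (ZLBA) if for every $J\in Si(I)$ the join $\bigvee_B J$ of the elements of $J$ exists in $B$. $\mathbf{ZLBA}$ is the full subcategory of $\mathbf{LBA}$ whose objects are all ZLBAs. Two categories are dually equivalent if one is equivalent to the opposite of the other. *)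

(* Defs.v *)
From HB Require Import structures.
From mathcomp Require Import all_boot all_order.
From mathcomp Require Import all_classical.
From mathcomp Require Import topology.

Set Implicit Arguments.
Unset Strict Implicit.
Unset Printing Implicit Defensive.

Local Open Scope classical_set_scope.
Local Open Scope order_scope.

Record category := Category {
  obj :> Type;
  hom : obj -> obj -> Type;
  idm : forall X, hom X X;
  compm : forall X Y Z, hom Y Z -> hom X Y -> hom X Z;
  compm1 : forall X Y (f : hom X Y), compm f (idm X) = f;
  comp1m : forall X Y (f : hom X Y), compm (idm Y) f = f;
  compmA : forall W X Y Z (f : hom Y Z) (g : hom X Y) (h : hom W X),
    compm f (compm g h) = compm (compm f g) h }.

Arguments hom {c} X Y.
Arguments idm {c} X.
Arguments compm {c X Y Z} f g.

Definition opposite (C : category) : category :=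
  @Category C (fun X Y => @hom C Y X) (@idm C)
    (fun X Y Z f g => compm g f)
    (fun X Y f => comp1m f) (fun X Y f => compm1 f)
    (fun W X Y Z f g h => esym (compmA h g f)).

Definition full_subcategory (C : category) (P : C -> Prop) : category :=
  @Category {X : C | P X} (fun X Y => hom (sval X) (sval Y))
    (fun X => idm (sval X)) (fun X Y Z f g => compm f g)
    (fun X Y f => compm1 f) (fun X Y f => comp1m f)
    (fun W X Y Z f g h => compmA f g h).

Record functor (C D : category) := Functor {
  fobj :> C -> D;
  fmap : forall X Y, hom X Y -> hom (fobj X) (fobj Y);
  fmap1 : forall X, fmap (idm X) = idm (fobj X);
  fmapM : forall X Y Z (f : hom Y Z) (g : hom X Y),
    fmap (compm f g) = compm (fmap f) (fmap g) }.

Arguments fmap {C D} F {X Y} f : rename.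

Definition id_functor (C : category) : functor C C :=
  @Functor C C id (fun X Y f => f) (fun X => erefl) (fun X Y Z f g => erefl).

Program Definition comp_functor (C D E : category)
    (G : functor D E) (F : functor C D) : functor C E :=
  @Functor C E (fun X => G (F X)) (fun X Y f => fmap G (fmap F f)) _ _.
Next Obligation. by move=> C D E G F X /=; rewrite !fmap1. Qed.
Next Obligation. by move=> C D E G F X Y Z f g /=; rewrite !fmapM. Qed.

Definition is_iso (C : category) (X Y : C) (f : hom X Y) :=
  exists g : hom Y X, compm g f = idm X /\ compm f g = idm Y.

Definition naturally_isomorphic (C D : category) (F G : functor C D) :=
  exists a : forall X : C, hom (F X) (G X),
    (forall (X Y : C) (f : hom X Y),
       compm (fmap G f) (a X) = compm (a Y) (fmap F f)) /\
    (forall X, is_iso (a X)).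

Definition equivalent (C D : category) :=
  exists (F : functor C D) (G : functor D C),
    naturally_isomorphic (comp_functor G F) (id_functor C) /\
    naturally_isomorphic (comp_functor F G) (id_functor D).

Definition dually_equivalent (C D : category) := equivalent C (opposite D).

Program Definition Top : category :=
  @Category topologicalType (fun X Y => continuousType X Y)
    (fun X => idfun) (fun X Y Z g f => g \o f) _ _ _.
Next Obligation. by move=> X Y f; apply/continuousEP. Qed.
Next Obligation. by move=> X Y f; apply/continuousEP. Qed.
Next Obligation. by move=> W X Y Z f g h; apply/continuousEP. Qed.

(* [zero_dimensional] of the library only says that distinct points are
   separated by clopen sets; a base of clopen sets is required here.
   [locally_compact] asks for a closed compact neighbourhood of each point,
   where closedness is automatic in a Hausdorff space.
   A [topologicalType] may be empty. *)
Definition is_ZLC (X : topologicalType) :=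
  [/\ basis (@clopen X), locally_compact [set: X] & hausdorff_space X].

Definition ZLC : category := full_subcategory (C := Top) is_ZLC.

Section Ideals.
Context {d : Order.disp_t} {B : ctbDistrLatticeType d}.
Implicit Types I J : set B.

(* Ideals of a subset [I] of [B] closed under joins, in the induced order;
   ideals of [B] itself are obtained with [I := setT]. *)
Definition is_ideal I J :=
  [/\ J `<=` I, J !=set0,
      forall a b, J a -> I b -> b <= a -> J b
    & forall a b, J a -> J b -> J (a `|` b)].

Definition is_dense I :=
  forall a : B, a != \bot -> exists b : B, [/\ I b, b != \bot & b <= a].

Definition ideal_neg I J : set B :=
  [set a | I a /\ forall b, J b -> a `&` b = \bot].

Definition is_simple_ideal I J :=
  is_ideal I J /\ [set a `|` b | a in J & b in ideal_neg I J] = I.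

End Ideals.

(* No axiom of [ctbDistrLatticeType] excludes [\bot = \top]. *)
Record lba := Lba {
  lba_disp : Order.disp_t;
  lba_alg : ctbDistrLatticeType lba_disp;
  lba_ideal : set lba_alg;
  lba_idealP : is_ideal [set: lba_alg] lba_ideal;
  lba_denseP : is_dense lba_ideal }.

Definition boolean_morphism d (B : ctbDistrLatticeType d)
    d' (B' : ctbDistrLatticeType d') (f : B -> B') :=
  [/\ Order.meet_morphism f, Order.join_morphism f,
      f \bot = \bot, f \top = \top & {morph f : a / ~` a}].

Record lba_hom (A A' : lba) := LbaHom {
  lba_fun :> lba_alg A -> lba_alg A';
  lba_fun_morph : boolean_morphism lba_fun;
  lba_fun_cofinal : forall b, lba_ideal b ->
    exists a, lba_ideal a /\ b <= lba_fun a }.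

Lemma lba_hom_eq (A A' : lba) (f g : lba_hom A A') : f =1 g -> f = g.
Proof.
case: f g => [f f1 f2] [g g1 g2] /= /funext fg; rewrite -{}fg in g1 g2 *.
by congr LbaHom; exact: Prop_irrelevance.
Qed.

Program Definition lba_id (A : lba) : lba_hom A A := @LbaHom A A id _ _.
Next Obligation. by []. Qed.
Next Obligation. by move=> A b Ib; exists b. Qed.

Program Definition lba_comp (A A' A'' : lba)
    (g : lba_hom A' A'') (f : lba_hom A A') : lba_hom A A'' :=
  @LbaHom A A'' (g \o f) _ _.
Next Obligation.
move=> A A' A'' [g [gI gU g0 g1 gC] ?] [f [fI fU f0 f1 fC] ?] /=.
by split=> [a b|a b|||a] /=; rewrite ?(fI, fU, f0, f1, fC) ?(gI, gU, gC).
Qed.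
Next Obligation.
move=> A A' A'' g f c /(lba_fun_cofinal g)[b [Ib cb]].
have [a [Ia ba]] := lba_fun_cofinal f Ib.
exists a; split=> //=; apply: (Order.POrderTheory.le_trans cb).
have [gI _ _ _ _] := lba_fun_morph g.
by apply/Order.MeetTheory.meet_idPl; rewrite -gI; congr (g _);
  apply/Order.MeetTheory.meet_idPl.
Qed.

Program Definition LBA : category :=
  @Category lba lba_hom lba_id lba_comp _ _ _.
Next Obligation. by move=> A A' f; apply: lba_hom_eq. Qed.
Next Obligation. by move=> A A' f; apply: lba_hom_eq. Qed.
Next Obligation. by move=> ? ? ? ? f g h; apply: lba_hom_eq. Qed.

Definition is_ZLBA (A : lba) :=
  forall J : set (lba_alg A), is_simple_ideal (@lba_ideal A) J ->
    exists s, isLub J s.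

Definition ZLBA : category := full_subcategory (C := LBA) is_ZLBA.

(* Main.v *)
(* Stone duality.  A space X is sent to the algebra of its clopen sets, with the
   compact clopen sets as ideal; an LBA (B, I) is sent to the space of the
   ultrafilters of B that meet I.  Points correspond to such ultrafilters by
   compactness, and density of I makes B embed into the clopen sets of its
   spectrum.  The ZLBA condition gives surjectivity: for a clopen set U of the
   spectrum, the elements of I whose basic open set lies in U form a simple
   ideal, because the intersection of U with the compact basic open set of an
   element of I is again basic, and the join of this ideal represents U. *)
From HB Require Import structures.
From mathcomp Require Import all_boot all_order.
From mathcomp Require Import all_classical.
From mathcomp Require Import topology.
Require Import Defs.

Set Implicit Arguments.
Unset Strict Implicit.
Unset Printing Implicit Defensive.

Import Order.Theory.

Local Open Scope classical_set_scope.
Local Open Scope order_scope.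

(** * Preliminaries: natural isomorphisms, ultrafilters, compactness *)

(** The chosen inverses are natural because the naturality square of [a] can be conjugated by them.
    This allows a unit that points from the identity to the composite functor. *)
Lemma naturally_isomorphic_sym (C D : category) (F G : functor C D) :
  naturally_isomorphic F G -> naturally_isomorphic G F.
Proof.
move=> [a [nat_a iso_a]]; pose b X := sval (cid (iso_a X)).
have ab X : compm (b X) (a X) = idm _ /\ compm (a X) (b X) = idm _.
  by rewrite /b; case: cid.
exists b; split=> [X Y f|X]; last by have [ba1 ab1] := ab X; exists (a X).
have [_ abX] := ab X; have [baY _] := ab Y.
rewrite -[LHS]comp1m -baY -compmA (compmA (a Y)) -nat_a -compmA abX.
by rewrite compm1.
Qed.

(** Joins are recovered by De Morgan and [\bot] as the complement of [\top]. *)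
Lemma boolean_morphism_meetC d (B : ctbDistrLatticeType d)
    d' (B' : ctbDistrLatticeType d') (f : B -> B') :
  {morph f : a b / a `&` b} -> {morph f : a / ~` a} -> f \top = \top ->
  boolean_morphism f.
Proof.
move=> fI fC f1; split=> // [a b|]; apply: (can_inj complK).
  by rewrite complU -!fC -fI complU.
by rewrite -fC !compl0.
Qed.

Section BooleanMorphism.
Context {d : Order.disp_t} {B : ctbDistrLatticeType d}.
Context {d' : Order.disp_t} {B' : ctbDistrLatticeType d'}.
Variable f : B -> B'.
Hypothesis fP : boolean_morphism f.

Lemma bmorphI a b : f (a `&` b) = f a `&` f b. Proof. by case: fP. Qed.
Lemma bmorphU a b : f (a `|` b) = f a `|` f b. Proof. by case: fP. Qed.
Lemma bmorph0 : f \bot = \bot. Proof. by case: fP. Qed.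
Lemma bmorph1 : f \top = \top. Proof. by case: fP. Qed.
Lemma bmorphC a : f (~` a) = ~` f a. Proof. by case: fP. Qed.

Lemma bmorph_le a b : a <= b -> f a <= f b.
Proof. by move=> /meet_idPl ab; apply/meet_idPl; rewrite -bmorphI ab. Qed.

Lemma bmorph_inv (g : B' -> B) : cancel f g -> cancel g f -> boolean_morphism g.
Proof.
move=> fK gK; split=> [a b|a b|||a]; apply: (can_inj fK); rewrite gK.
- by rewrite bmorphI !gK.
- by rewrite bmorphU !gK.
- by rewrite bmorph0.
- by rewrite bmorph1.
- by rewrite bmorphC gK.
Qed.

End BooleanMorphism.

(* The maximal [F] need not be assumed upward closed: maximality forces it to
   be an ultrafilter containing [i]. *)
Lemma exists_boolean_morphism d (B : ctbDistrLatticeType d) (i : B) :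
  i != \bot -> exists u : B -> bool, boolean_morphism u /\ u i.
Proof.
move=> i0.
(* Families closed under meets whose members all meet [i]. The empty family satisfies [P], which
   covers the empty chain in Zorn's lemma. *)
pose P := [set F : set B | (forall a b, F a -> F b -> F (a `&` b)) /\
                            forall a, F a -> a `&` i != \bot].
have [F [[FI Fi] Fmax]] : exists F, P F /\ forall G, F `<` G -> ~ P G.
  apply: Zorn_bigcup => S SP Stot.
  split=> [a b [F SF Fa] [G SG Gb]|a [F SF Fa]].
    have [FG|GF] := Stot F G SF SG.
      by exists G => //; have [+ _] := SP G SG; apply=> //; apply: FG.
    by exists F => //; have [+ _] := SP F SF; apply=> //; apply: GF.
  by have [_] := SP F SF; apply.
(* Adjoining [c] and all meets [a /\ c] to [F] preserves [P] under these conditions, so maximality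
   forces [c] into [F]. *)
have Fadd c : c `&` i != \bot -> (forall a, F a -> (a `&` c) `&` i != \bot) ->
    F c.
  move=> ci Fci; apply: contrapT => nFc.
  pose G := [set x | [\/ F x, x = c | exists2 a, F a & x = a `&` c]].
  apply: (Fmax G).
    by split=> [x Fx|GF]; [apply: Or31|apply/nFc/GF/Or32].
  split=> [x y|x]; last by case=> [/Fi|->|[a Fa ->]] //; apply: Fci.
  move=> [Fx|->|[a Fa ->]] [Fy|->|[b Fb ->]]; rewrite ?meetxx.
  - exact/Or31/FI.
  - by apply: Or33; exists x.
  - by rewrite meetA; apply: Or33; exists (x `&` b) => //; apply: FI.
  - by rewrite meetC; apply: Or33; exists y.
  - exact: Or32.
  - by rewrite meetCA meetxx; apply: Or33; exists b.
  - by rewrite meetAC; apply: Or33; exists (a `&` y) => //; apply: FI.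
  - by rewrite -meetA meetxx; apply: Or33; exists a.
  - by rewrite meetACA meetxx; apply: Or33; exists (a `&` b) => //; apply: FI.
have Fin : F i by apply: Fadd => [|a Fa]; rewrite ?meetxx // -meetA meetxx Fi.
have Fle a b : F a -> a <= b -> F b.
  move=> Fa ab; apply: Fadd => [|c Fc].
    apply: contraNneq (Fi a Fa) => bi; rewrite -lex0 -bi.
    exact: leI2.
  apply: contraNneq (Fi _ (FI _ _ Fc Fa)) => cbi; rewrite -lex0 -cbi.
  by apply: leI2 => //; apply: leI2.
have F0 : ~ F \bot by move=> /Fi; rewrite meet0x eqxx.
have FE a : F (~` a) <-> ~ F a.
  split=> [Fca Fa|nFa]; first by have := FI _ _ Fa Fca; rewrite meetxC.
  (* A member of [F] disjoint from [a] lies below the complement of [a]. Hence, if that complement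
     is not in [F], then [a] is compatible with [i] and with all of [F], and [Fadd] applies to
     it. *)
  have meetF b : F b -> b `&` a = \bot -> F (~` a).
    by move=> Fb /eqP; rewrite disj_leC => /(Fle _ _ Fb).
  apply: contrapT => nFca; apply: nFa; apply: Fadd => [|b Fb].
    by apply/eqP; rewrite meetC => ia; apply/nFca/(meetF _ Fin ia).
  by apply/eqP; rewrite meetAC => bia; apply/nFca/(meetF _ (FI _ _ Fb Fin) bia).
have F1 : F \top by apply: Fle Fin (lex1 _).
have uI : Order.meet_morphism (fun a => `[< F a >]).
  move=> a b; apply/asboolP/andP => [Fab|[/asboolP Fa /asboolP Fb]].
    by split; apply/asboolP; apply: Fle Fab _; rewrite ?leIl ?leIr.
  exact: FI.
have uC : {morph (fun a => `[< F a >]) : a / ~` a}.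
  by move=> a; rewrite complEbool -asbool_neg; apply/asbool_equiv_eq.
exists (fun a => `[< F a >]); split; last exact/asboolP.
by apply: boolean_morphism_meetC => //; rewrite asboolT.
Qed.

(** If no single [U i] covered [K], directedness would make the sets [K \ U i] a base of a proper
    filter. A cluster point of it in [K] lies in some open [U i], which misses [K \ U i]. *)
Lemma compact_directed_cover (T : topologicalType) (I : Type) (K : set T)
    (D : set I) (U : I -> set T) :
    compact K -> D !=set0 ->
    (forall i j, D i -> D j ->
       exists2 k, D k & (U i `|` U j `<=` U k)%classic) ->
    (forall i, D i -> open (U i)) -> K `<=` \bigcup_(i in D) U i ->
  exists2 i, D i & K `<=` U i.
Proof.
move=> Kc D0 UD Uo KU; apply: contrapT => nex.
pose F := filter_from D (fun i => K `\` U i)%classic.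
have FF : ProperFilter F.
  apply: filter_from_proper => [|i Di].
    apply: filter_from_filter => // i j Di Dj.
    have [k Dk ijk] := UD i j Di Dj; exists k => // x [Kx nUkx].
    by split; split=> // ?; apply/nUkx/ijk; [left|right].
  apply: contrapT => /nonemptyPn KUi0; apply: nex; exists i => //.
  by rewrite -setD_eq0.
have [|x [Kx clx]] := Kc F FF.
  by have [i Di] := D0; exists i => // x [].
have [i Di Uix] := KU x Kx.
have [] := clx (K `\` U i)%classic (U i); first by exists i.
- exact/open_nbhs_nbhs/(conj (Uo i Di)).
- by move=> y [[_ /[apply]]].
Qed.

(** * The spectrum of a local Boolean algebra *)

Lemma lba2_idealP : is_ideal [set: bool] [set: bool].
Proof. by split=> //; exists true. Qed.

Lemma lba2_denseP : is_dense [set: bool].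
Proof. by move=> a a0; exists a. Qed.

Definition lba2 : lba := Lba lba2_idealP lba2_denseP.

(* A Boolean homomorphism to [bool] is the indicator of an ultrafilter;
   being cofinal means that this ultrafilter meets the ideal. *)
Definition spec (A : lba) := lba_hom A lba2.

HB.instance Definition _ (A : lba) := gen_eqMixin (spec A).
HB.instance Definition _ (A : lba) := gen_choiceMixin (spec A).

Section Spectrum.
Variable A : lba.
Local Notation B := (lba_alg A).
Local Notation I := (@lba_ideal A).
Implicit Types (u v : spec A) (a b i : B).

Lemma bounded_cofinal (p : B -> bool) : (exists2 i, I i & p i) ->
  forall c : lba_alg lba2, lba_ideal c -> exists a, I a /\ c <= p a.
Proof. by move=> [i Ii pi] c _; exists i; rewrite pi; split=> //; case: c. Qed.

Definition spec_of (p : B -> bool) (pP : boolean_morphism p)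
    (pI : exists2 i, I i & p i) : spec A :=
  @LbaHom A lba2 p pP (bounded_cofinal pI).

Definition basic_open a : set (spec A) := [set u : spec A | (u a : bool)].

Lemma basic_openI a b :
  basic_open (a `&` b) = (basic_open a `&` basic_open b)%classic.
Proof.
by apply/predeqP=> u; rewrite /basic_open /= (bmorphI (lba_fun_morph u));
  split=> /andP.
Qed.

Lemma basic_openU a b :
  basic_open (a `|` b) = (basic_open a `|` basic_open b)%classic.
Proof.
by apply/predeqP=> u; rewrite /basic_open /= (bmorphU (lba_fun_morph u));
  split=> /orP.
Qed.

Lemma basic_openC a : basic_open (~` a) = (~` basic_open a)%classic.
Proof.
apply/predeqP=> u; rewrite /basic_open /= (bmorphC (lba_fun_morph u)).
by split=> /negP.
Qed.

Lemma basic_open0 : basic_open \bot = set0.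
Proof.
by apply/predeqP=> u; rewrite /basic_open /= (bmorph0 (lba_fun_morph u)).
Qed.

Lemma basic_open1 : basic_open \top = setT.
Proof.
by apply/predeqP=> u; rewrite /basic_open /= (bmorph1 (lba_fun_morph u)).
Qed.

Lemma spec_bounded u : exists2 i, I i & basic_open i u.
Proof.
have [//|i [Ii ui]] := @lba_fun_cofinal _ _ u true.
by exists i; rewrite // /basic_open /=; move: ui; case: (lba_fun u i).
Qed.

Definition spec_open (U : set (spec A)) :=
  forall u, U u -> exists2 a, basic_open a u & basic_open a `<=` U.

Lemma spec_openT : spec_open setT.
Proof. by move=> u _; exists \top; rewrite ?basic_open1. Qed.

Lemma spec_openI : setI_closed spec_open.
Proof.
move=> U V Uo Vo u [/Uo[a ua aU] /Vo[b ub bV]].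
by exists (a `&` b); rewrite basic_openI //; apply: setISS.
Qed.

Lemma spec_open_bigU (T : Type) (f : T -> set (spec A)) :
  (forall t, spec_open (f t)) -> spec_open (\bigcup_t f t).
Proof.
by move=> fo u [t _ /fo[a ua af]]; exists a => // v /af ftv; exists t.
Qed.

HB.instance Definition _ := isOpenTopological.Build (spec A)
  spec_openT spec_openI spec_open_bigU.

Lemma open_basic_open a : open (basic_open a).
Proof. by move=> u ua; exists a. Qed.

Lemma closed_basic_open a : closed (basic_open a).
Proof. by rewrite -openC -basic_openC; apply: open_basic_open. Qed.

Lemma clopen_basic_open a : clopen (basic_open a).
Proof. by split; [apply: open_basic_open|apply: closed_basic_open]. Qed.

Lemma nbhs_spec u (U : set (spec A)) :
  nbhs u U <-> exists2 a, basic_open a u & basic_open a `<=` U.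
Proof.
rewrite nbhsE; split=> [[V [Vo Vu] VU]|[a ua aU]].
  by have [a ua aV] := Vo u Vu; exists a => //; apply: subset_trans aV VU.
by exists (basic_open a) => //; split=> //; apply: open_basic_open.
Qed.

(** An ultrafilter [F] on the spectrum induces the ultrafilter of all [a] with [basic_open a] in
    [F]. It contains [i], hence meets the ideal and is a point of the spectrum; [F] converges to
    this point. *)
Lemma compact_basic_open i : I i -> compact (basic_open i).
Proof.
move=> Ii; rewrite compact_ultra => F FF Fi.
have FC a : F (basic_open (~` a)) <-> ~ F (basic_open a).
  rewrite basic_openC; split=> [FCa Fa|nFa].
    by have [u []] := filter_ex (filterI Fa FCa).
  by have [|//] := in_ultra_setVsetC (basic_open a) FF.
have fP : boolean_morphism (fun a => `[< F (basic_open a) >]).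
  apply: boolean_morphism_meetC => [a b|a|].
  - rewrite andEbool -asbool_and basic_openI.
    apply/asbool_equiv_eq; split=> [Fab|[]]; last exact: filterI.
    by split; apply: filterS Fab => u [].
  - by rewrite complEbool -asbool_neg; apply/asbool_equiv_eq.
  - by rewrite asboolT //; rewrite basic_open1; apply: filterT.
exists (spec_of fP (ex_intro2 _ _ i Ii (asboolT Fi))).
split; first exact/asboolP.
by move=> U /nbhs_spec[a /asboolP Fa aU]; apply: filterS aU Fa.
Qed.

Lemma nbhs_basic_open u a : basic_open a u -> nbhs u (basic_open a).
Proof. by move=> ua; apply/nbhs_spec; exists a. Qed.

(** One inclusion between ultrafilters suffices: applied to complements, it gives the other. *)
Lemma spec_eq u v : (forall a, basic_open a u -> basic_open a v) -> u = v.
Proof.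
move=> uv; apply: lba_hom_eq => a; apply/idP/idP; first exact: uv.
apply: contraTT => /negP nua; apply/negP.
by have := uv (~` a); rewrite !basic_openC; apply.
Qed.

Lemma spec_hausdorff : hausdorff_space (spec A).
Proof.
move=> u v uv; apply: spec_eq => a ua; apply: contrapT => nva.
have [|w []] := uv (basic_open a) (basic_open (~` a)) (nbhs_basic_open ua).
  by apply: nbhs_basic_open; rewrite basic_openC.
by rewrite basic_openC.
Qed.

Lemma spec_ZLC : is_ZLC (spec A).
Proof.
split; last exact: spec_hausdorff.
- split=> [U []//|u U /nbhs_spec[a ua aU]]; exists (basic_open a) => //.
  by split=> //; apply: clopen_basic_open.
- move=> u _; rewrite withinET; have [i Ii iu] := spec_bounded u.
  exists (basic_open i); first by apply: nbhs_basic_open.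
  by split; [apply: compact_basic_open|apply: closed_basic_open].
Qed.

(** Density is used here: it gives a nonzero [i] of the ideal below [a], and an ultrafilter through
    [i] meets the ideal, so it is a point. *)
Lemma basic_open_neq0 a : a != \bot -> basic_open a !=set0.
Proof.
move=> /(lba_denseP (l := A))[i [Ii i0 ia]].
have [u [uP ui]] := exists_boolean_morphism i0.
exists (spec_of uP (ex_intro2 _ _ i Ii ui)); rewrite /basic_open /=.
by have := bmorph_le uP ia; rewrite ui; case: (u a).
Qed.

(** If [a <= b] fails, then [a] meets the complement of [b] in a nonzero element, whose basic open
    set has a point. *)
Lemma basic_open_le a b : (basic_open a `<=` basic_open b) = (a <= b) :> Prop.
Proof.
apply/propext; split=> [ab|/meet_idPl <-]; last by rewrite basic_openI => u [].
apply/negPn/negP; rewrite -[b in _ <= b]complK -disj_leC.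
move=> /basic_open_neq0[u]; rewrite basic_openI basic_openC => -[/ab ub].
exact.
Qed.

Lemma basic_open_inj : injective basic_open.
Proof.
by move=> a b ab; apply/le_anti/andP; split; rewrite -basic_open_le ab.
Qed.

(** The basic open sets of ideal elements contained in [K] form a directed cover of [K], so one of
    them is all of [K]. *)
Lemma compact_open_basic (K : set (spec A)) : compact K -> open K ->
  exists2 i, I i & basic_open i = K.
Proof.
move=> Kc Ko; have [_ [i0 Ii0] Ile IU] := lba_idealP A.
pose D := [set i | I i /\ basic_open i `<=` K].
have [||||i [Ii iK] Ki] := @compact_directed_cover _ _ K D basic_open Kc.
- exists \bot; split; first by apply: Ile Ii0 _ (le0x _).
  by rewrite basic_open0.
- move=> i j [Ii iK] [Ij jK]; exists (i `|` j); rewrite ?basic_openU //.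
  by split; [apply: IU|rewrite basic_openU subUset].
- by move=> i _; apply: open_basic_open.
- move=> u Ku; have [a ua aK] := Ko u Ku; have [i Ii ui] := spec_bounded u.
  exists (i `&` a); rewrite ?basic_openI //; split.
    by apply: Ile Ii _ (leIl _ _).
  by rewrite basic_openI => v [_ /aK].
- by exists i => //; apply/seteqP.
Qed.

Lemma clopen_basic (U : set (spec A)) : is_ZLBA A -> clopen U ->
  exists a, basic_open a = U.
Proof.
move=> AZ [Uo Uc]; have [_ [i0 Ii0] Ile IU] := lba_idealP A.
pose J := [set i | I i /\ basic_open i `<=` U].
have split_ideal i : I i ->
    exists j k, [/\ J j, ideal_neg I J k & j `|` k = i].
  move=> Ii.
  have [j Ij jE] : exists2 j, I j & basic_open j = (basic_open i `&` U)%classic.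
    apply: compact_open_basic; last first.
      by apply: openI Uo; apply: open_basic_open.
    exact: compact_closedI (compact_basic_open Ii) Uc.
  have ji : j <= i by rewrite -basic_open_le jE; apply: subIsetl.
  (* The basic open set of the remainder of [i] after [j] lies outside [U], so this remainder is
     disjoint from every element of [J]. *)
  exists j, (i `&` ~` j); split.
  - by split=> // u; rewrite jE => -[].
  - split=> [|k [Ik kU]]; first exact: Ile Ii _ (leIl _ _).
    apply: basic_open_inj; rewrite !basic_openI basic_openC jE basic_open0.
    by rewrite -subset0 => u [[iu /not_andP[]]] // nUu /kU.
  - by rewrite joinIr joinxC meetx1 join_r.
have Jsimple : is_simple_ideal I J.
  split; first split.
  - by move=> i [].
  - exists \bot; split; first by apply: Ile Ii0 _ (le0x _).
    by rewrite basic_open0.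
  - move=> i j [Ii iU] Ij; rewrite -basic_open_le => ji.
    by split=> //; apply: subset_trans ji iU.
  - move=> i j [Ii iU] [Ij jU]; split; first exact: IU.
    by rewrite basic_openU subUset.
  - apply/seteqP; split=> [_ [j [Ij _]] [k [Ik _]] <-|i Ii]; first exact: IU.
    by have [j [k [Jj Jk <-]]] := split_ideal i Ii; exists j => //; exists k.
have [a [aub alub]] := AZ J Jsimple; exists a; apply/seteqP; split; last first.
  (* Around each point of [U] there is an element [i /\ b] of [J], and the join [a] lies above
     it. *)
  move=> u Uu; have [b ub bU] := Uo u Uu; have [i Ii ui] := spec_bounded u.
  have : J (i `&` b).
    split; first exact: Ile Ii _ (leIl _ _).
    by rewrite basic_openI => v [_ /bU].
  by move=> /aub; rewrite -basic_open_le; apply; rewrite basic_openI.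
move=> u ua; apply: contrapT => nUu.
have [b ub bU] : exists2 b, basic_open b u & (basic_open b `<=` ~` U)%classic.
  by apply: (closed_openC Uc).
(* Here [b] separates [u] from [U]. Removing [b] from [a] leaves an upper bound of [J], so leastness
   of [a] contradicts that [u] lies in both basic open sets. *)
have : a <= a `&` ~` b.
  apply: alub => j [Ij jU]; rewrite lexI aub //= -basic_open_le basic_openC.
  by move=> v /jU Uv /bU.
by rewrite -basic_open_le basic_openI basic_openC => /(_ u ua)[].
Qed.

End Spectrum.

(** * The local Boolean algebra of clopen sets *)

Record clopens (X : topologicalType) :=
  Clopens { clopen_set :> set X; clopen_setP : clopen clopen_set }.

HB.instance Definition _ (X : topologicalType) := gen_eqMixin (clopens X).
HB.instance Definition _ (X : topologicalType) := gen_choiceMixin (clopens X).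

Section ClopenAlgebra.
Variable X : topologicalType.
Implicit Types U V W : clopens X.

Lemma clopens_eq U V : (U : set X) = V -> U = V.
Proof.
case: U V => [U Uc] [V Vc] /= UV; rewrite -UV in Vc *.
by congr Clopens; apply: Prop_irrelevance.
Qed.

Definition clopens_le U V := `[< U `<=` V >].
Definition clopens_lt U V := (V != U) && clopens_le U V.
Definition clopens_meet U V :=
  Clopens (clopenI (clopen_setP U) (clopen_setP V)).
Definition clopens_join U V :=
  Clopens (clopenU (clopen_setP U) (clopen_setP V)).
Definition clopens_compl U := Clopens (clopenC set0 (clopen_setP U)).

Lemma clopens_le_def U V : clopens_le U V = (clopens_meet U V == U).
Proof.
apply/asboolP/eqP => [/setIidPl UV|<-]; first exact: clopens_eq.
by move=> x [].
Qed.

Lemma clopens_lt_def U V : clopens_lt U V = (V != U) && clopens_le U V.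
Proof. by []. Qed.

Lemma clopens_meetC : commutative clopens_meet.
Proof. by move=> U V; apply/clopens_eq/setIC. Qed.
Lemma clopens_joinC : commutative clopens_join.
Proof. by move=> U V; apply/clopens_eq/setUC. Qed.
Lemma clopens_meetA : associative clopens_meet.
Proof. by move=> U V W; apply/clopens_eq/setIA. Qed.
Lemma clopens_joinA : associative clopens_join.
Proof. by move=> U V W; apply/clopens_eq/setUA. Qed.
Lemma clopens_joinKI V U : clopens_meet U (clopens_join U V) = U.
Proof. by apply/clopens_eq; rewrite /= setUC setKU. Qed.
Lemma clopens_meetKU V U : clopens_join U (clopens_meet U V) = U.
Proof. by apply/clopens_eq; rewrite /= setIC setKI. Qed.
Lemma clopens_meetUl : left_distributive clopens_meet clopens_join.
Proof. by move=> U V W; apply/clopens_eq/setIUl. Qed.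
Lemma clopens_meetxx : idempotent_op clopens_meet.
Proof. by move=> U; apply/clopens_eq/setIid. Qed.

HB.instance Definition _ :=
  @Order.isMeetJoinDistrLattice.Build set_display (clopens X) _ _ _ _
    clopens_le_def clopens_lt_def clopens_meetC clopens_joinC
    clopens_meetA clopens_joinA clopens_joinKI clopens_meetKU clopens_meetUl
    clopens_meetxx.

Lemma clopens_le0x U : Clopens (@clopen0 X) <= U.
Proof. by apply/asboolP; apply: sub0set. Qed.
Lemma clopens_lex1 U : U <= Clopens (@clopenT X).
Proof. by apply/asboolP; apply: subsetT. Qed.

HB.instance Definition _ :=
  Order.hasBottom.Build set_display (clopens X) clopens_le0x.
HB.instance Definition _ :=
  Order.hasTop.Build set_display (clopens X) clopens_lex1.

Lemma clopens_joinxC U : U `|` clopens_compl U = \top.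
Proof. exact/clopens_eq/setUv. Qed.
Lemma clopens_meetxC U : U `&` clopens_compl U = \bot.
Proof. exact/clopens_eq/setICr. Qed.

HB.instance Definition _ :=
  Order.TBDistrLattice_hasComplement.Build set_display (clopens X)
    clopens_joinxC clopens_meetxC.

Lemma clopens_leP U V : reflect (U `<=` V) (U <= V).
Proof. exact: asboolP. Qed.

End ClopenAlgebra.

Definition compact_clopens (X : topologicalType) : set (clopens X) :=
  [set K | compact (K : set X)].

Lemma compact_clopens_ideal (X : topologicalType) :
  is_ideal [set: clopens X] (@compact_clopens X).
Proof.
split=> // [|K U Kc _ /clopens_leP UK|K L]; last exact: compactU.
  by exists \bot; apply: compact0.
by apply: subclosed_compact UK => //; case: (clopen_setP U).
Qed.

(** A clopen neighbourhood chosen inside a compact neighbourhood is closed in it, hence compact. *)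
Lemma compact_clopen_nbhs (X : topologicalType) (x : X) (U : set X) :
  is_ZLC X -> nbhs x U ->
  exists K : clopens X, [/\ compact K, clopen_set K x & K `<=` U].
Proof.
move=> [[_ Xb] Xlc _]; have := Xlc x I; rewrite withinET => -[C xC [Cc Ccl]].
move=> /(filterI xC)/Xb[V [Vc Vx] VCU]; exists (Clopens Vc); split=> //=.
  by apply: subclosed_compact Cc _; [case: Vc|move=> y /VCU[]].
by move=> y /VCU[].
Qed.

Lemma compact_clopens_dense (X : topologicalType) : is_ZLC X ->
  is_dense (@compact_clopens X).
Proof.
move=> XZ U U0; have [x Ux] : U !=set0.
  by apply: contrapT => /nonemptyPn U0'; case/eqP: U0; apply: clopens_eq.
have [|K [Kc Kx KU]] := compact_clopen_nbhs (x := x) (U := U) XZ.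
  by apply: open_nbhs_nbhs; split=> //; case: (clopen_setP U).
exists K; split=> //; last exact/clopens_leP.
by apply/eqP => K0; rewrite K0 in Kx.
Qed.

Definition clopen_lba (X : topologicalType) (XZ : is_ZLC X) : lba :=
  Lba (@compact_clopens_ideal X) (compact_clopens_dense XZ).

(** The union of a simple ideal [J] is open, and simplicity makes its complement the union of the
    ideal of elements disjoint from [J], which is open too. The union of [J] is therefore clopen and
    is the join. *)
Lemma clopen_ZLBA (X : topologicalType) (XZ : is_ZLC X) :
  is_ZLBA (clopen_lba XZ).
Proof.
move=> J [[JK _ _ _] Js].
pose U := (\bigcup_(K in J) clopen_set K)%classic.
pose V :=
  (\bigcup_(K in ideal_neg (@compact_clopens X) J) clopen_set K)%classic.
have UV : V = (~` U)%classic.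
  apply/seteqP; split=> [x [L [_ LJ] Lx] [K KJ Kx]|x nUx].
    have : clopen_set (L `&` K) x by [].
    by rewrite LJ.
  (* A compact clopen [K] around [x] splits as a join of [L] in [J] and [M] disjoint from [J]; since
     [x] is outside [U], it lies in [M]. *)
  have [K [Kc Kx _]] := compact_clopen_nbhs XZ (@filterT _ (nbhs x) _).
  have : @lba_ideal (clopen_lba XZ) K by [].
  rewrite -Js => -[L LJ [M MJ LMK]]; exists M => //.
  have [Lx|//] : clopen_set (L `|` M) x by rewrite LMK.
  by case: nUx; exists L.
have Uo : open U by apply: bigcup_open => K _; case: (clopen_setP K).
have Vo : open V by apply: bigcup_open => K _; case: (clopen_setP K).
have Uc : clopen U by split=> //; rewrite -openC -UV.
exists (Clopens Uc); split=> [K JK'|W WJ]; apply/clopens_leP => /=.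
  by move=> x Kx; exists K.
by move=> x [K /WJ /clopens_leP KW /KW].
Qed.

(** * Action on morphisms and the two functors *)

Section ClopenMap.
Context {X Y : topologicalType} (XZ : is_ZLC X) (YZ : is_ZLC Y).
Variable f : continuousType X Y.

Definition clopen_preimage (V : clopens Y) : clopens X :=
  Clopens (preimage_clopen (clopen_setP V) (@cts_fun _ _ f)).

Lemma clopen_preimage_morph : boolean_morphism clopen_preimage.
Proof. by split=> [U V|U V|||U]; apply: clopens_eq. Qed.

(** The compact clopen sets of [Y] form a directed cover of [Y], so their preimages form a directed
    cover of the compact set [K]. *)
Lemma clopen_preimage_cofinal K : @lba_ideal (clopen_lba XZ) K ->
  exists L, @lba_ideal (clopen_lba YZ) L /\ K <= clopen_preimage L.
Proof.
move=> Kc; have [||||L Lc /clopens_leP KL] := @compact_directed_cover _ _ K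
  (@compact_clopens Y) (fun L => clopen_set (clopen_preimage L)) Kc.
- by exists \bot; apply: compact0.
- by move=> L M Lc Mc; exists (L `|` M) => //; apply: compactU.
- by move=> L _; case: (clopen_setP (clopen_preimage L)).
- move=> x _; have [L [Lc Lfx _]] :=
    compact_clopen_nbhs YZ (@filterT _ (nbhs (f x)) _).
  by exists L.
- by exists L.
Qed.

Definition clopen_map : lba_hom (clopen_lba YZ) (clopen_lba XZ) :=
  @LbaHom (clopen_lba YZ) (clopen_lba XZ) _
    clopen_preimage_morph clopen_preimage_cofinal.

End ClopenMap.

Section SpecMap.
Context {A A' : lba} (phi : lba_hom A A').

(** Points are morphisms into [lba2], so precomposition acts on them; cofinality of [phi] keeps the
    resulting ultrafilter meeting the ideal. *)
Definition spec_map (u : spec A') : spec A := lba_comp u phi.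

Lemma continuous_spec_map : continuous spec_map.
Proof.
move=> u U /nbhs_spec[a ua aU]; apply/nbhs_spec; exists (phi a) => // v va.
exact: aU.
Qed.

HB.instance Definition _ := isContinuous.Build _ _ spec_map continuous_spec_map.

End SpecMap.

Program Definition clopen_functor : functor ZLC (opposite ZLBA) :=
  @Functor ZLC (opposite ZLBA)
    (fun X => exist is_ZLBA (clopen_lba (proj2_sig X))
                            (@clopen_ZLBA _ (proj2_sig X)))
    (fun X Y f => clopen_map (proj2_sig X) (proj2_sig Y) f) _ _.
Next Obligation. by move=> X; apply: lba_hom_eq => U; apply: clopens_eq. Qed.
Next Obligation.
by move=> X Y Z f g; apply: lba_hom_eq => U; apply: clopens_eq.
Qed.

Program Definition spec_functor : functor (opposite ZLBA) ZLC :=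
  @Functor (opposite ZLBA) ZLC
    (fun A => exist is_ZLC (spec (sval A) : topologicalType)
                           (spec_ZLC (sval A)))
    (fun A A' phi => spec_map phi : continuousType _ _) _ _.
Next Obligation. by move=> A; apply/continuousEP => u; apply: lba_hom_eq. Qed.
Next Obligation.
by move=> A A' A'' f g; apply/continuousEP => u; apply: lba_hom_eq.
Qed.

(** * A space is the spectrum of its clopen algebra *)

Section PointEvaluation.
Variables (X : topologicalType) (XZ : is_ZLC X).
Local Notation A := (clopen_lba XZ).

Definition mem_at (x : X) (U : clopens X) : bool := `[< clopen_set U x >].

Lemma mem_at_morph x : boolean_morphism (mem_at x).
Proof.
apply: boolean_morphism_meetC => [U V|U|].
- by rewrite andEbool -asbool_and.
- by rewrite complEbool -asbool_neg.
- exact: asboolT.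
Qed.

Lemma mem_at_bounded x : exists2 K, compact_clopens K & mem_at x K.
Proof.
have [K [Kc Kx _]] := compact_clopen_nbhs XZ (@filterT _ (nbhs x) _).
by exists K => //; apply/asboolP.
Qed.

Definition point_eval (x : X) : spec A :=
  @spec_of A _ (mem_at_morph x) (mem_at_bounded x).

Lemma basic_open_point_eval x (U : clopens X) :
  @basic_open A U (point_eval x) <-> clopen_set U x.
Proof. by split=> /asboolP. Qed.

Lemma continuous_point_eval : continuous point_eval.
Proof.
move=> x N /nbhs_spec[U /basic_open_point_eval Ux UN].
have [Uo _] := clopen_setP U.
apply: filterS (open_nbhs_nbhs (conj Uo Ux)) => y Uy.
exact/UN/basic_open_point_eval.
Qed.

Lemma point_eval_inj : injective point_eval.
Proof.
move=> x y xy; have [_ _ Xh] := XZ; apply: Xh => M N Mx Ny.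
have [K [_ Kx KM]] := compact_clopen_nbhs XZ Mx.
(* Equal evaluations place [y] in every clopen set containing [x], so [y] itself witnesses that the
   two neighbourhoods meet. *)
exists y; split; last exact: nbhs_singleton.
by apply/KM/basic_open_point_eval; rewrite -xy; apply/basic_open_point_eval.
Qed.

Lemma point_eval_surj u : exists x, point_eval x = u.
Proof.
have [K Kc uK] := spec_bounded u.
(* Otherwise the clopen sets outside the ultrafilter [u] cover [K]. They are closed under joins
   because [u] is prime, so one of them contains [K], although [K] belongs to [u]. *)
have [x [Kx xu]] : exists x, clopen_set K x /\
    forall V : lba_alg A, clopen_set V x -> basic_open V u.
  apply: contrapT => nex.
  have [||||V nuV KV] := @compact_directed_cover _ (lba_alg A) K
    [set V | ~ basic_open V u] (@clopen_set X) Kc.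
  - by exists \bot; rewrite /= basic_open0.
  - move=> V W nuV nuW; exists (V `|` W) => //.
    by rewrite /= basic_openU => -[].
  - by move=> V _; case: (clopen_setP V).
  - move=> x Kx; apply: contrapT => nV; apply: nex; exists x; split=> // V Vx.
    by apply: contrapT => nuV; apply: nV; exists V.
  - have : (K : lba_alg A) <= V by apply/clopens_leP.
    by rewrite -basic_open_le => /(_ u uK).
by exists x; apply: spec_eq => V /basic_open_point_eval/xu.
Qed.

Lemma point_eval_iso :
  @is_iso Top X (spec A) (mkcts continuous_point_eval).
Proof.
pose g u := sval (cid (point_eval_surj u)).
have gK u : point_eval (g u) = u by rewrite /g; case: cid.
(* The preimage under [g] of a clopen set [K] is the basic open set of [K]. *)
have g_cont : continuous g.
  move=> u N /(compact_clopen_nbhs XZ)[K [_ Kgu KN]].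
  apply/nbhs_spec; exists K => [|v].
    by rewrite -(gK u); apply/basic_open_point_eval.
  by rewrite -{1}(gK v) => /basic_open_point_eval/KN.
exists (mkcts g_cont : continuousType (spec A) X).
split; apply/continuousEP => x /=; last exact: gK.
by apply: point_eval_inj; exact: gK.
Qed.

End PointEvaluation.

(** * A ZLBA is the clopen algebra of its spectrum *)

Section BasicClopen.
Variables (A : lba) (AZ : is_ZLBA A).

Definition basic_clopen (a : lba_alg A) : clopens (spec A) :=
  Clopens (clopen_basic_open a).

Lemma basic_clopen_morph : boolean_morphism basic_clopen.
Proof.
split=> [a b|a b|||a]; apply: clopens_eq => /=.
- exact: basic_openI.
- exact: basic_openU.
- exact: basic_open0.
- exact: basic_open1.
- exact: basic_openC.
Qed.

Lemma basic_clopen_cofinal K : @lba_ideal (clopen_lba (spec_ZLC A)) K ->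
  exists a, @lba_ideal A a /\ K <= basic_clopen a.
Proof.
move=> Kc; have [|i Ii iK] := compact_open_basic Kc.
  by case: (clopen_setP K).
by exists i; split=> //; apply/clopens_leP; rewrite /= iK.
Qed.

Definition basic_clopen_hom : lba_hom A (clopen_lba (spec_ZLC A)) :=
  @LbaHom A (clopen_lba (spec_ZLC A)) _
    basic_clopen_morph basic_clopen_cofinal.

(** Injectivity rests on density and surjectivity on the ZLBA condition. The inverse is cofinal
    because each [a] in the ideal is the image of its own compact basic open set. *)
Lemma basic_clopen_iso :
  @is_iso LBA A (clopen_lba (spec_ZLC A)) basic_clopen_hom.
Proof.
pose g (U : clopens (spec A)) := sval (cid (clopen_basic AZ (clopen_setP U))).
have gK : cancel g basic_clopen.
  by move=> U; apply: clopens_eq; rewrite /g; case: cid.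
have Kg : cancel basic_clopen g.
  by move=> a; apply: basic_open_inj; rewrite /g /=; case: cid.
have gP := bmorph_inv basic_clopen_morph Kg gK.
have gc a : @lba_ideal A a ->
    exists K, @lba_ideal (clopen_lba (spec_ZLC A)) K /\ a <= g K.
  move=> Ia; exists (basic_clopen a); rewrite Kg; split=> //.
  exact: compact_basic_open.
exists (@LbaHom (clopen_lba (spec_ZLC A)) A g gP gc).
by split; apply: lba_hom_eq => x /=; [apply: Kg|apply: gK].
Qed.

End BasicClopen.

Theorem theorem1p17 : dually_equivalent ZLC ZLBA.
Proof.
exists clopen_functor, spec_functor; split.
- apply: naturally_isomorphic_sym.
  exists (fun X : ZLC => mkcts (continuous_point_eval (XZ := proj2_sig X))
    : continuousType _ _).
  split=> [X Y f|X]; last exact: point_eval_iso.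
  by apply/continuousEP => x; apply: lba_hom_eq.
(* In the opposite category [basic_clopen_hom] points from the composite functor to the identity, as
   required. *)
- exists (fun A : ZLBA => basic_clopen_hom (sval A)).
  split=> [A A' f|A].
    by apply: lba_hom_eq => a; apply: clopens_eq.
  have [g [g1 g2]] := basic_clopen_iso (proj2_sig A).
  by exists g.
Qed.
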